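(* Let $H(u,v,z,t)=\sum_w u^{\mathrm{asc}(w)}v^{\mathrm{last}(w)}z^{\mathrm{zeros}(w)}t^{\mathrm{length}(w)}$, summed over all nonempty ascent sequences $w$. For $s\ge1$ put $\delta_s=u-(1-t)^s(u-1)$ and $\gamma_s=u-(1-zt)(1-t)^{s-1}(u-1)$, and $\delta_0=1$. Then, as formal power series in $u,z,t$, $$H(u,1,z,t)=\sum_{s\ge0}\frac{zt(1-u)u^s(1-t)^s}{\delta_s\prod_{i=1}^{s+1}\gamma_i}.$$
   Context: An ascent sequence of length $n$ is a sequence $(x_1,\dots,x_n)$ of nonnegative integers with $x_1=0$ and $x_i\in[0,1+\mathrm{asc}(x_1,\dots,x_{i-1})]$ for $2\le i\le n$, where $\mathrm{asc}(y_1,\dots,y_k)=|\{1\le j<k: y_j<y_{j+1}\}|$. For an ascent sequence $w$: $\mathrm{length}(w)$ is its number of entries, $\mathrm{asc}(w)$ its number of ascents, $\mathrm{last}(w)$ its rightmost entry, $\mathrm{zeros}(w)$ its number of entries equal to 0. Each $\delta_s,\gamma_s$ has constant term 1, so the quotients are formal power series, and the $s$-th summand is divisible by $u^s$, so the sum converges formally. *)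

(* Defs.v *)
From mathcomp Require Import all_boot all_order all_algebra.
Set Implicit Arguments. Unset Strict Implicit. Unset Printing Implicit Defensive.
Import Order.TTheory GRing.Theory Num.Theory.
Local Open Scope ring_scope.

Definition asc (s : seq nat) : nat :=
  count (fun p : nat * nat => (p.1 < p.2)%N) (zip s (behead s)).

Definition last_entry (s : seq nat) : nat := last 0%N s.

Definition zeros (s : seq nat) : nat := count (pred1 0%N) s.

Definition is_ascent (s : seq nat) : bool :=
  [&& s != [::], nth 0%N s 0 == 0%N &
      all (fun i => nth 0%N s i <= (asc (take i s)).+1)%N (iota 1 (size s).-1)].

(* number of ascent sequences of length n with asc = a and zeros = b.
   Entries of an ascent sequence of length n are <= n-1, so enumerating
   n-tuples with entries in 'I_(n.+1) is exhaustive. *)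
Definition asc_count (a b n : nat) : nat :=
  #|[set w : n.-tuple 'I_n.+1 |
       let s := map (@nat_of_ord _) (tval w) in
       [&& is_ascent s, asc s == a & zeros s == b]]|.

(* f a b n = coefficient of u^a z^b t^n *)
Definition fps := nat -> nat -> nat -> rat.

Definition fps_const (c : rat) : fps :=
  fun a b n => if [&& a == 0%N, b == 0%N & n == 0%N] then c else 0.
Definition fps_one : fps := fps_const 1.
Definition fpsU : fps := fun a b n => if [&& a == 1%N, b == 0%N & n == 0%N] then 1 else 0.
Definition fpsZ : fps := fun a b n => if [&& a == 0%N, b == 1%N & n == 0%N] then 1 else 0.
Definition fpsT : fps := fun a b n => if [&& a == 0%N, b == 0%N & n == 1%N] then 1 else 0.

Definition fps_add (f g : fps) : fps := fun a b n => f a b n + g a b n.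
Definition fps_opp (f : fps) : fps := fun a b n => - f a b n.
Definition fps_sub (f g : fps) : fps := fps_add f (fps_opp g).
Definition fps_mul (f g : fps) : fps := fun a b n =>
  \sum_(i < a.+1) \sum_(j < b.+1) \sum_(k < n.+1)
     f i j k * g (a - i)%N (b - j)%N (n - k)%N.
Definition fps_pow (f : fps) (k : nat) : fps := iter k (fps_mul f) fps_one.

(* Inverse of a series f with constant term 1: writing f = 1 - g (g has zero
   constant term), 1/f = sum_k g^k, and g^k has no monomial of total degree < k,
   so the coefficient of u^a z^b t^n only involves k <= a+b+n. *)
Definition fps_inv (f : fps) : fps := fun a b n =>
  \sum_(k < (a + b + n).+1) fps_pow (fps_sub fps_one f) k a b n.

Definition fps_sums_to (F : nat -> fps) (G : fps) : Prop :=
  forall a b n, exists N : nat, forall M : nat, (N <= M)%N ->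
    \sum_(s < M) F s a b n = G a b n.

Definition H_v1 : fps := fun a b n => (asc_count a b n)%:R.

Definition delta (s : nat) : fps :=
  if s == 0%N then fps_one
  else fps_sub fpsU (fps_mul (fps_pow (fps_sub fps_one fpsT) s)
                             (fps_sub fpsU fps_one)).

Definition gamma (s : nat) : fps :=
  fps_sub fpsU (fps_mul (fps_mul (fps_sub fps_one (fps_mul fpsZ fpsT))
                                 (fps_pow (fps_sub fps_one fpsT) s.-1))
                        (fps_sub fpsU fps_one)).

Definition summand (s : nat) : fps :=
  fps_mul
    (fps_mul (fps_mul (fps_mul fpsZ fpsT) (fps_sub fps_one fpsU))
             (fps_mul (fps_pow fpsU s) (fps_pow (fps_sub fps_one fpsT) s)))
    (fps_inv (fps_mul (delta s)
                      (\big[fps_mul/fps_one]_(1 <= i < s.+2) gamma i))).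

(* Main.v *)
From HB Require Import structures.
Require Import Defs.
From mathcomp Require Import all_boot all_order all_algebra.
From mathcomp Require Import boolp ring zify.
Set Implicit Arguments. Unset Strict Implicit. Unset Printing Implicit Defensive.
Import GRing.Theory.
Local Open Scope ring_scope.

(* Appending a letter [i] to an ascent sequence [w] gives, according to whether
   [i = 0], [0 < i <= last w] or [last w < i <= asc w + 1], the equation
     (1 - v) H(u,v) = (1 - v) zt (1 + H(u,1)) + tv (H(u,1) - H(u,v))
                      + utv (H(u,v) - v H(uv,1)).
   At [v = 1 / delta_1 = 1 / (1 + t(u - 1))] the terms in [H(u,v)] cancel, leaving
     gamma_1 H(u,1) = zt(1 - u) + (u / delta_1) H(u / delta_1, 1).
   The substitution [u -> u / delta_1] sends [delta_s] to [delta_(s+1) / delta_1]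
   and [gamma_s] to [gamma_(s+1) / delta_1], so iterating it produces the sum.
   To avoid substituting into power series, [H] is cut at length [N]; it is then a
   finite sum that can be evaluated at any elements of a commutative ring, and each
   step holds up to a multiple of [t^(N+1)]. *)

(** * The ring of formal power series in one variable *)

(** A named copy of [nat -> R] that can carry the convolution product. Nested three times over [rat]
    it unfolds to [fps], with [u] outermost and [t] innermost. *)
Definition series (R : Type) : Type := nat -> R.
HB.instance Definition _ (R : Type) := gen_eqMixin (series R).
HB.instance Definition _ (R : Type) := gen_choiceMixin (series R).

Section SeriesRing.
Variable R : comNzRingType.
Implicit Types f g h : series R.

Definition series_add f g : series R := fun n => f n + g n.
Definition series_opp f : series R := fun n => - f n.
Definition series_mul f g : series R := fun n => \sum_(i < n.+1) f i * g (n - i)%N.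
Definition series_one : series R := fun n => (n == 0%N)%:R.

Lemma series_addA : associative series_add.
Proof. by move=> f g h; apply: funext => n; exact: addrA. Qed.
Lemma series_addC : commutative series_add.
Proof. by move=> f g; apply: funext => n; exact: addrC. Qed.
Lemma series_add0 : left_id (fun=> 0) series_add.
Proof. by move=> f; apply: funext => n; exact: add0r. Qed.
Lemma series_addN : left_inverse (fun=> 0) series_opp series_add.
Proof. by move=> f; apply: funext => n; exact: addNr. Qed.

HB.instance Definition _ :=
  GRing.isZmodule.Build (series R) series_addA series_addC series_add0 series_addN.

Definition series_trunc k f : {poly R} := \poly_(i < k) f i.

(* The ring axioms are inherited from polynomials through truncations. *)
Lemma series_mul_trunc k f g n : (n < k)%N ->
  series_mul f g n = (series_trunc k f * series_trunc k g)`_n.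
Proof.
move=> ltnk; rewrite coefM; apply: eq_bigr => i _; rewrite !coef_poly.
by rewrite (leq_ltn_trans _ ltnk) ?leq_ord// (leq_ltn_trans _ ltnk) ?leq_subr.
Qed.

Lemma series_trunc_mul k f g n : (n < k)%N ->
  (series_trunc k (series_mul f g))`_n = (series_trunc k f * series_trunc k g)`_n.
Proof. by move=> ltnk; rewrite coef_poly ltnk; exact: series_mul_trunc. Qed.

Lemma series_mulC : commutative series_mul.
Proof. by move=> f g; apply: funext => n; rewrite !(@series_mul_trunc n.+1)// mulrC. Qed.

Lemma series_mulA : associative series_mul.
Proof.
move=> f g h; apply: funext => n; rewrite !(@series_mul_trunc n.+1)//.
transitivity ((series_trunc n.+1 f * (series_trunc n.+1 g * series_trunc n.+1 h))`_n).
  rewrite [LHS]coefM [RHS]coefM; apply: eq_bigr => i _.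
  by rewrite series_trunc_mul// ltnS leq_subr.
rewrite mulrA [LHS]coefM [RHS]coefM; apply: eq_bigr => i _.
by rewrite series_trunc_mul// ltn_ord.
Qed.

Lemma series_mul1 : left_id series_one series_mul.
Proof.
move=> f; apply: funext => n; rewrite /series_mul big_ord_recl subn0 mul1r.
by rewrite big1 ?addr0// => i _; rewrite mul0r.
Qed.

Lemma series_mulDl : left_distributive series_mul series_add.
Proof.
move=> f g h; apply: funext => n; rewrite /series_mul /series_add -big_split.
by apply: eq_bigr => i _; rewrite mulrDl.
Qed.

Lemma series_one_neq0 : series_one != 0 :> series R.
Proof.
by apply/eqP => /(congr1 (fun f : series R => f 0%N)) /eqP; rewrite oner_eq0.
Qed.

HB.instance Definition _ :=
  GRing.Zmodule_isComNzRing.Build (series R)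
    series_mulA series_mulC series_mul1 series_mulDl series_one_neq0.

Lemma series_sum_apply (I : Type) (r : seq I) (P : pred I) (F : I -> series R) n :
  (\sum_(i <- r | P i) F i) n = \sum_(i <- r | P i) F i n.
Proof. by apply: (big_morph (fun f : series R => f n)). Qed.

Lemma series_mulE f g n : (f * g) n = \sum_(i < n.+1) f i * g (n - i)%N.
Proof. by []. Qed.

Definition series_X : series R := fun n => (n == 1%N)%:R.
Definition series_C (c : R) : series R := fun n => if n == 0%N then c else 0.

Lemma series_coefXM f n : (series_X * f) n = if n is m.+1 then f m else 0.
Proof.
rewrite series_mulE big_ord_recl mul0r add0r.
case: n => [|n]; first by rewrite big_ord0.
rewrite big_ord_recl mul1r big1 ?addr0 => [|i _]; last by rewrite mul0r.
by rewrite /= subn1.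
Qed.

Lemma series_coefCM c f n : (series_C c * f) n = c * f n.
Proof.
rewrite series_mulE big_ord_recl subn0 big1 ?addr0// => i _.
by rewrite mul0r.
Qed.

Lemma series_coefXnM k f n :
  (series_X ^+ k * f) n = if (n < k)%N then 0 else f (n - k)%N.
Proof.
elim: k n => [|k IH] n; first by rewrite mul1r ltn0 subn0.
by rewrite exprS -mulrA series_coefXM; case: n.
Qed.
End SeriesRing.


(** * Enumeration of ascent sequences by appending a letter *)

(* Indexed so that [ascents n] lists the ascent sequences of length [n.+1]. *)
Fixpoint ascents (n : nat) : seq (seq nat) :=
  if n is m.+1 then [seq rcons w i | w <- ascents m, i <- iota 0 (asc w).+2]
  else [:: [:: 0%N]].

Lemma ascentsS n :
  ascents n.+1 = [seq rcons w i | w <- ascents n, i <- iota 0 (asc w).+2].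
Proof. by []. Qed.

Lemma asc_cons2 x y s : asc (x :: y :: s) = ((x < y) + asc (y :: s))%N.
Proof. by []. Qed.

Lemma asc_rcons w i : w != [::] -> asc (rcons w i) = (asc w + (last_entry w < i))%N.
Proof.
case: w => // x w _; elim: w x => [|y w IH] x; first by rewrite /asc /= addn0.
by rewrite !rcons_cons !asc_cons2 -rcons_cons IH addnA.
Qed.

Lemma zeros_rcons w i : zeros (rcons w i) = (zeros w + (i == 0%N))%N.
Proof. by rewrite /zeros -cats1 count_cat /= addn0. Qed.

Lemma asc_le_size w : (asc w <= (size w).-1)%N.
Proof.
by rewrite (leq_trans (count_size _ _))// size_zip size_behead geq_minr.
Qed.

(** The condition on an entry involves only the prefix before it, so appending a letter leaves the
    earlier conditions untouched. *)
Lemma is_ascent_rcons w i : w != [::] ->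
  is_ascent (rcons w i) = is_ascent w && (i <= (asc w).+1)%N.
Proof.
case: w => // x w _; rewrite /is_ascent.
have -> : (size (rcons (x :: w) i)).-1 = (size w + 1)%N by rewrite size_rcons addn1.
rewrite iotaD all_cat /= add0n andbT -andbA; congr (_ && (_ && _)).
  apply: eq_in_all => j; rewrite mem_iota add1n => /andP[_ ltj].
  by rewrite -!rcons_cons nth_rcons /= ltj -cats1 -cat_cons takel_cat //= ltnW.
by rewrite nth_rcons ltnn eqxx -cats1 take_size_cat.
Qed.

Lemma mem_ascents n w : (w \in ascents n) = is_ascent w && (size w == n.+1).
Proof.
elim: n w => [|n IH] w; last rewrite ascentsS.
  by rewrite inE; case: w => [|x [|y w]] /=; rewrite /is_ascent ?eqseq_cons /= ?andbF ?andbT.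
apply/allpairsPdep/idP => [[w' [i [w'in]]]|].
  rewrite mem_iota add0n ltnS => /= lei ->.
  move: w'in; rewrite IH => /andP[w'a /eqP sw'].
  rewrite is_ascent_rcons ?w'a ?size_rcons ?sw' ?eqxx ?lei//.
  by rewrite -size_eq0 sw'.
case/lastP: w => [|w i]; first by rewrite andbF.
rewrite size_rcons eqSS => /andP[wa /eqP sw].
move: wa; rewrite is_ascent_rcons; last by rewrite -size_eq0 sw.
case/andP=> wa lei; exists w, i; split=> //; first by rewrite IH wa sw eqxx.
by rewrite mem_iota.
Qed.

Lemma ascents_neq_nil n w : w \in ascents n -> w != [::].
Proof. by rewrite mem_ascents => /andP[_]; case: w. Qed.

Lemma ascents_uniq n : uniq (ascents n).
Proof.
elim: n => [|n IH] //; rewrite ascentsS; apply: allpairs_uniq_dep => // [w _|].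
  exact: iota_uniq.
by move=> [w i] [w' i'] _ _ /= /rcons_inj [-> ->].
Qed.

(** An appended letter above the last one is at most [asc w + 1] and creates an ascent; otherwise
    the bound is inherited. This lets the range of the next letter be split at the last entry. *)
Lemma last_ascents n w : w \in ascents n -> (last_entry w <= asc w)%N.
Proof.
elim: n w => [|n IH] w; first by rewrite inE => /eqP->.
rewrite ascentsS => /allpairsPdep[w' [i [w'in + ->]]]; rewrite mem_iota add0n ltnS /= => lei.
rewrite /last_entry last_rcons asc_rcons ?(ascents_neq_nil w'in)//.
have := IH _ w'in; case: ltnP => /=; lia.
Qed.

Lemma ascents_entry_le n w i : w \in ascents n -> i \in w -> (i <= n)%N.
Proof.
elim: n w => [|n IH] w; first by rewrite inE => /eqP->; rewrite inE => /eqP->.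
rewrite ascentsS => /allpairsPdep[w' [j [w'in + ->]]]; rewrite mem_iota add0n ltnS /= => lej.
rewrite mem_rcons inE => /predU1P[->|]; last by move/(IH _ w'in)/leqW.
have := asc_le_size w'; move: w'in; rewrite mem_ascents => /andP[_ /eqP->] /=; lia.
Qed.

Lemma asc_count0 a b : asc_count a b 0 = 0%N.
Proof.
by apply: eq_card0 => w; rewrite inE (tuple0 w).
Qed.

Lemma asc_countS a b n :
  asc_count a b n.+1 = count (fun w => (asc w == a) && (zeros w == b)) (ascents n).
Proof.
rewrite /asc_count -size_filter; set A := [set _ | _].
pose f (w : n.+1.-tuple 'I_n.+2) : seq nat := map (@nat_of_ord _) (tval w).
have f_inj : injective f by move=> w w' /(inj_map val_inj) /val_inj.
rewrite cardE -(size_map f); apply/perm_size/uniq_perm.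
- by rewrite map_inj_uniq ?enum_uniq.
- by rewrite filter_uniq ?ascents_uniq.
move=> w; rewrite mem_filter mem_ascents; apply/mapP/idP => [[w']|].
  rewrite mem_enum inE => /and3P[wa wb wc] ->.
  by rewrite wa wb wc size_map size_tuple eqxx.
case/andP=> wab wsz.
have win : w \in ascents n by rewrite mem_ascents.
case/andP: wsz => wa /eqP sw.
(* Entries are at most [n], so [inord] loses nothing and every listed sequence comes from a
   tuple. *)
have szw : size (map (@inord n.+1) w) == n.+1 by rewrite size_map sw.
have fw : f (Tuple szw) = w.
  rewrite /f /= -map_comp -[RHS]map_id; apply/eq_in_map => i iw /=.
  by rewrite inordK// ltnS (leq_trans (ascents_entry_le win iw)).
by exists (Tuple szw); rewrite // mem_enum inE -/(f (Tuple szw)) fw wa.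
Qed.

(** * The functional equation and its kernel *)

Section Kernel.
Variable R : comNzRingType.
Implicit Types x v z t : R.

(** The coefficient of [t ^+ n.+1] in H, evaluated at arbitrary ring elements. *)
Definition ascent_poly z n x v : R :=
  \sum_(w <- ascents n) x ^+ asc w * z ^+ zeros w * v ^+ last_entry w.

Lemma sub1r_mul_geom v m n : (m <= n)%N ->
  (1 - v) * (\sum_(m <= i < n) v ^+ i) = v ^+ m - v ^+ n.
Proof.
move=> lemn; rewrite mulr_sumr -[RHS]opprB -telescope_sumr// -sumrN.
by apply: eq_bigr => i _; rewrite exprS; ring.
Qed.

Lemma ascent_polyS z n x v :
  (1 - v) * ascent_poly z n.+1 x v =
  (1 - v) * z * ascent_poly z n x 1 +
  v * (ascent_poly z n x 1 - ascent_poly z n x v) +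
  x * v * (ascent_poly z n x v - v * ascent_poly z n (x * v) 1).
Proof.
rewrite /ascent_poly ascentsS big_allpairs_dep !mulr_sumr -!sumrB !mulr_sumr -!big_split /=.
rewrite !big_seq; apply: eq_bigr => w win.
have wn0 := ascents_neq_nil win; have lw := last_ascents win.
under eq_bigr => i _ do
  rewrite asc_rcons// zeros_rcons /last_entry last_rcons -/(last_entry w) !exprD.
(* The letter 0 is set apart, being the only one to change [zeros]; the others split according to
   whether they exceed the last entry and so add an ascent. *)
rewrite big_cons -[_ :: iota _ _]/(index_iota 1 (asc w).+2) ltn0 expr0 !mulr1.
rewrite (@big_cat_nat _ _ _ (last_entry w).+1) //=; last by lia.
set X := x ^+ asc w; set Y := z ^+ zeros w; set l := last_entry w in lw *.
rewrite (eq_big_nat _ _ (F2 := fun i => X * Y * v ^+ i)); last first.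
  by case=> [|i] // /andP[_]; rewrite ltnS => /leq_gtF ->; rewrite !mulr1.
rewrite [X in _ + (_ + X)](eq_big_nat _ _ (F2 := fun i => X * x * Y * v ^+ i)); last first.
  by case=> [|i] // /andP[-> _]; rewrite !mulr1 expr1.
rewrite -!mulr_sumr.
have E1 := @sub1r_mul_geom v 1 l.+1 isT.
have E2 := @sub1r_mul_geom v l.+1 (asc w).+2 ltac:(lia).
move: E1 E2; set s1 := \sum_(_ <= _ < _) _; set s2 := \sum_(_ <= _ < _) _ => E1 E2.
have -> : (1 - v) * (X * (Y * z) + (X * Y * s1 + X * x * Y * s2)) =
  (1 - v) * z * X * Y + X * Y * ((1 - v) * s1) + X * x * Y * ((1 - v) * s2) by ring.
by rewrite E1 E2 exprMn !expr1n -/X !exprS; ring.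
Qed.

Definition ascent_gf z t N x v : R :=
  \sum_(n < N) t ^+ n.+1 * ascent_poly z n x v.

Lemma ascent_gf_eq z t N x v :
  (1 - v) * (ascent_gf z t N x v - t * z + t ^+ N.+1 * ascent_poly z N x v) =
  t * ((1 - v) * z * ascent_gf z t N x 1 +
       v * (ascent_gf z t N x 1 - ascent_gf z t N x v) +
       x * v * (ascent_gf z t N x v - v * ascent_gf z t N (x * v) 1)).
Proof.
have -> : ascent_gf z t N x v - t * z + t ^+ N.+1 * ascent_poly z N x v =
    \sum_(n < N) t ^+ n.+2 * ascent_poly z n.+1 x v.
  (* The sum up to [N] is peeled at both ends: dropping its first term [t * z] leaves the shifted
     sum, whose top term has degree [N.+1]. *)
  have E : \sum_(n < N.+1) t ^+ n.+1 * ascent_poly z n x v =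
    ascent_gf z t N x v + t ^+ N.+1 * ascent_poly z N x v by rewrite big_ord_recr.
  have z0 : ascent_poly z 0 x v = z.
    by rewrite /ascent_poly big_seq1 /= !expr0 expr1 mul1r mulr1.
  by rewrite big_ord_recl /= expr1 z0 in E; rewrite addrAC -E addrAC subrr add0r.
rewrite /ascent_gf -!sumrB.
rewrite !mulr_sumr -!sumrB !mulr_sumr -!big_split mulr_sumr /=; apply: eq_bigr => n _.
have := ascent_polyS z n x v.
set A := ascent_poly z n.+1 x v => E.
have -> : (1 - v) * (t ^+ n.+2 * A) = t ^+ n.+2 * ((1 - v) * A) by ring.
by rewrite E !exprS; ring.
Qed.

(** The coefficient of H(x,v) in [ascent_gf_eq] is [1 - v * (1 + t * (x - 1))], which is zero here.
    What remains has the factor [t * v], where [t] is regular and [v] invertible. *)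
Lemma ascent_gf_kernel z t N x v : GRing.lreg t -> v * (1 + t * (x - 1)) = 1 ->
  (1 + z * t * (x - 1)) * ascent_gf z t N x 1 =
  (x - 1) * (t ^+ N.+1 * ascent_poly z N x v - t * z) +
  x * v * ascent_gf z t N (x * v) 1.
Proof.
move=> t_reg kerv; have := ascent_gf_eq z t N x v.
move: (ascent_gf z t N x v) (ascent_gf z t N x 1) (ascent_gf z t N (x * v) 1)
  (t ^+ N.+1 * ascent_poly z N x v) => Hv H1 Hxv r E.
apply/esym/eqP; rewrite -subr_eq0; apply/eqP.
set D := _ - _.
have tvD : t * (v * D) = t * 0.
  (* The last product, a multiple of the kernel, trades each [1 - v] for [v * t * (x - 1)]. *)
  rewrite mulr0; transitivity (((1 - v) * (Hv - t * z + r) -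
     t * ((1 - v) * z * H1 + v * (H1 - Hv) + x * v * (Hv - v * Hxv))) +
     (v * (1 + t * (x - 1)) - 1) * (Hv - t * z + r - t * z * H1)).
    by rewrite /D; ring.
  by rewrite E kerv !subrr mul0r addr0.
by rewrite -[D]mul1r -kerv mulrAC (t_reg _ _ tvD) mul0r.
Qed.

(** * Iteration of the kernel identity *)

Definition deltaR (u t : R) s : R := u - (1 - t) ^+ s * (u - 1).
Definition gammaR (u z t : R) s : R := u - (1 - z * t) * (1 - t) ^+ s.-1 * (u - 1).
Definition gamma_prod (u z t : R) s : R := \prod_(1 <= i < s.+1) gammaR u z t i.

Lemma gamma_prodS u z t s : gamma_prod u z t s.+1 = gamma_prod u z t s * gammaR u z t s.+1.
Proof. by rewrite /gamma_prod big_nat_recr. Qed.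

Section Iteration.
Variables (u z t : R) (N : nat) (idelta igprod : nat -> R).
Hypothesis t_reg : GRing.lreg t.
Hypothesis ideltaE : forall s, deltaR u t s * idelta s = 1.
Hypothesis igprodE : forall s, gamma_prod u z t s * igprod s = 1.

(** H(u,1) after [s] substitutions. The extra factor [idelta s] absorbs the denominator of the
    coefficient [gammaR u z t s.+1 * idelta s], so that the recurrence has coefficients
    [gammaR u z t s.+1] and [u]. *)
Definition iterate_gf s : R := ascent_gf z t N (u * idelta s) 1 * idelta s.

(* The kernel vanishes at [x = u / delta s], [v = delta s / delta s.+1], and then
   [x * v = u / delta s.+1]. *)
Lemma iterate_gf_step s : exists r : R,
  gammaR u z t s.+1 * iterate_gf s =
  z * t * (1 - u) * (1 - t) ^+ s * idelta s + u * iterate_gf s.+1 + t ^+ N.+1 * r.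
Proof.
rewrite /iterate_gf.
have := ideltaE s; have := ideltaE s.+1.
set d := deltaR u t s; set d' := deltaR u t s.+1.
move: (idelta s) (idelta s.+1) => i i' di' di; pose v := d * i'.
(* Divided by [d], this says that [d' / d] is [1 + t * (x - 1)] at [x = u / d], so [v = d / d'] is
   the root of the kernel. *)
have d'E : d' = d + t * (u - d) by rewrite /d /d' /deltaR exprS; ring.
have uvE : u * i * v = u * i'.
  by transitivity (u * i' * (d * i)); [rewrite /v; ring | rewrite di mulr1].
have kerv : v * (1 + t * (u * i - 1)) = 1.
  transitivity (d * i' + t * (u * i * v) - t * v); first by rewrite /v; ring.
  by rewrite uvE -di' d'E /v; ring.
have := ascent_gf_kernel z N t_reg kerv; rewrite uvE.
set x := u * i.
(* This turns [- (x - 1) * t * z] into the numerator of the [s]-th summand over [deltaR u t s]. *)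
have x1 : x - 1 = (1 - t) ^+ s * (u - 1) * i.
  by rewrite /x -[X in _ - X]di /d /deltaR; ring.
move: (ascent_gf z t N x 1) (ascent_gf z t N (u * i') 1) => H1 H2 E.
exists ((x - 1) * ascent_poly z N x v).
transitivity ((1 + z * t * (x - 1)) * H1).
  by rewrite -[X in X + _]di x1 /d /deltaR /gammaR /=; ring.
by rewrite E mulrBr {2}x1; ring.
Qed.

(** Unrolling the recurrence [M] times divides by one more gamma each time and gains a factor [u].
    Two errors remain: a tail divisible by [u ^+ M] and a truncation error divisible by
    [t ^+ N.+1]. *)
Lemma ascent_gf_partial_sum M : exists r : R,
  ascent_gf z t N u 1 =
  \sum_(s < M) z * t * (1 - u) * (u ^+ s * (1 - t) ^+ s) * (idelta s * igprod s.+1) +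
  u ^+ M * (iterate_gf M * igprod M) + t ^+ N.+1 * r.
Proof.
elim: M => [|M [r IH]].
  exists 0; rewrite big_ord0 add0r mulr0 addr0 expr0 mul1r /iterate_gf.
  have i0 : idelta 0 = 1.
    by rewrite -(ideltaE 0) /deltaR expr0; ring.
  have p0 : igprod 0 = 1.
    by rewrite -(igprodE 0) /gamma_prod big_geq// mul1r.
  by rewrite i0 p0 !mulr1.
have [r' step] := iterate_gf_step M.
rewrite IH big_ord_recr /=.
have := igprodE M; have := igprodE M.+1; rewrite gamma_prodS; move: step.
set s := \sum_(_ < _) _.
move: (gammaR u z t M.+1) (gamma_prod u z t M) (igprod M) (igprod M.+1) (iterate_gf M)
  (iterate_gf M.+1) => g P p p' F F' step Pp' Pp.
(* The inverse of the shorter product is the next gamma times the inverse of the longer one; this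
   produces the left side of [step]. *)
have pE : p = g * p'.
  by rewrite -[LHS]mul1r -Pp'; transitivity (g * p' * (P * p)); [ring | rewrite Pp mulr1].
exists (r + u ^+ M * p' * r').
transitivity (s + u ^+ M * p' * (g * F) + t ^+ N.+1 * r); first by rewrite pE; ring.
by rewrite step (exprS u); ring.
Qed.
End Iteration.
End Kernel.

(** * Series in [u], [z], [t] as an iterated series ring, and their coefficients *)

Local Notation fps_ring := (series (series (series rat))).
Local Notation uS := (fpsU : fps_ring).
Local Notation zS := (fpsZ : fps_ring).
Local Notation tS := (fpsT : fps_ring).

Lemma fps_mulE (f g : fps) : fps_mul f g = (f : fps_ring) * (g : fps_ring).
Proof.
apply: funext => a; apply: funext => b; apply: funext => n.
rewrite series_mulE !series_sum_apply; apply: eq_bigr => i _.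
by rewrite series_mulE series_sum_apply.
Qed.

Lemma fps_subE (f g : fps) : fps_sub f g = (f : fps_ring) - (g : fps_ring).
Proof. by []. Qed.

Lemma fps_oneE : fps_one = (1 : fps_ring).
Proof.
apply: funext => a; apply: funext => b; apply: funext => n.
by case: a b n => [|a] [|b] [|n].
Qed.

Lemma fps_powE (f : fps) k : fps_pow f k = (f : fps_ring) ^+ k.
Proof.
elim: k => [|k IH]; first exact: fps_oneE.
by rewrite exprS -IH -fps_mulE.
Qed.

Lemma fps_prodE m n (F : nat -> fps) :
  \big[fps_mul/fps_one]_(m <= i < n) F i = \prod_(m <= i < n) (F i : fps_ring).
Proof.
rewrite fps_oneE; apply: (big_ind2 (fun f g : fps_ring => f = g)) => // f f' g g' -> ->.
exact: fps_mulE.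
Qed.

Lemma fpsUE : fpsU = (series_X _ : fps_ring).
Proof.
apply: funext => a; apply: funext => b; apply: funext => n.
by case: a b n => [|[|a]] [|b] [|n].
Qed.

Lemma fpsZE : fpsZ = (series_C (series_X _) : fps_ring).
Proof.
apply: funext => a; apply: funext => b; apply: funext => n.
by case: a b n => [|a] [|[|b]] [|n].
Qed.

Lemma fpsTE : fpsT = (series_C (series_C (series_X _)) : fps_ring).
Proof.
apply: funext => a; apply: funext => b; apply: funext => n.
by case: a b n => [|a] [|b] [|[|n]].
Qed.

Lemma coef_fpsUXM k (f : fps_ring) a b n :
  (uS ^+ k * f) a b n = if (a < k)%N then 0 else f (a - k)%N b n.
Proof. by rewrite fpsUE series_coefXnM; case: ltnP. Qed.

Lemma coef_fpsZXM k (f : fps_ring) a b n :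
  (zS ^+ k * f) a b n = if (b < k)%N then 0 else f a (b - k)%N n.
Proof.
have -> : (zS ^+ k * f) a = series_X _ ^+ k * f a.
  rewrite fpsZE; elim: k => [|k IH]; first by rewrite !mul1r.
  by rewrite !exprS -!mulrA series_coefCM IH.
by rewrite series_coefXnM; case: ltnP.
Qed.

Lemma coef_fpsTXM k (f : fps_ring) a b n :
  (tS ^+ k * f) a b n = if (n < k)%N then 0 else f a b (n - k)%N.
Proof.
have -> : (tS ^+ k * f) a b = series_X _ ^+ k * f a b.
  rewrite fpsTE; elim: k => [|k IH]; first by rewrite !mul1r.
  by rewrite !exprS -!mulrA !series_coefCM IH.
by rewrite series_coefXnM; case: ltnP.
Qed.

Lemma coef_fps_monomial i j k a b n :
  (uS ^+ i * zS ^+ j * tS ^+ k) a b n = [&& i == a, j == b & k == n]%:R.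
Proof.
rewrite -mulrA coef_fpsUXM -(mulr1 (tS ^+ k)) coef_fpsZXM coef_fpsTXM.
have one_coef p q r : (1 : fps_ring) p q r = [&& p == 0, q == 0 & r == 0]%N%:R :> rat.
  by case: p q r => [|p] [|q] [|r].
have cmp x y : (x == y) = ~~ (y < x)%N && (y - x == 0)%N.
  by rewrite subn_eq0 -leqNgt eqn_leq.
rewrite one_coef (cmp i) (cmp j) (cmp k).
by do 3![case: ltnP => _ //=; rewrite ?andbF //].
Qed.

(** Multiplication by [t] only shifts coefficients, so they can be read back one degree higher. *)
Lemma fpsT_lreg : GRing.lreg tS.
Proof.
move=> f g Tfg; apply: funext => a; apply: funext => b; apply: funext => n.
have Tcoef h : (tS * h) a b n.+1 = h a b n.
  by have := coef_fpsTXM 1 h a b n.+1; rewrite expr1 subn1.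
by rewrite -(Tcoef f) -(Tcoef g); congr ((_ : fps_ring) _ _ _).
Qed.

Lemma fps_sum_apply (I : Type) (r : seq I) (P : pred I) (F : I -> fps_ring) a b n :
  (\sum_(i <- r | P i) F i) a b n = \sum_(i <- r | P i) F i a b n.
Proof. by rewrite !series_sum_apply. Qed.

(** * Total order of vanishing and inverses *)

Definition order_ge (k : nat) (f : fps_ring) : Prop :=
  forall a b n, (a + b + n < k)%N -> f a b n = 0.

Lemma order_geM j k (f g : fps_ring) :
  order_ge j f -> order_ge k g -> order_ge (j + k) (f * g).
Proof.
move=> fj gk a b n ltabn; rewrite -fps_mulE.
apply: big1 => i _; apply: big1 => l _; apply: big1 => m _.
have [lt_j|ge_j] := ltnP (i + l + m)%N j; first by rewrite fj ?mul0r.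
rewrite gk ?mulr0//.
by have := ltn_ord i; have := ltn_ord l; have := ltn_ord m; lia.
Qed.

Lemma order_geX k (f : fps_ring) : order_ge 1 f -> order_ge k (f ^+ k).
Proof.
move=> f1; elim: k => [|k IH] //; rewrite exprS; exact: (order_geM f1 IH).
Qed.

Definition const_term (f : fps_ring) : rat := f 0%N 0%N 0%N.

(** Powers of [1 - f] beyond the total degree do not contribute, so all the inner sums of [fps_inv]
    may run to a common bound [K]. The geometric sum then leaves only [(1 - f) ^+ K], of order above
    [a + b + n]. *)
Lemma fps_mulV (f : fps_ring) : const_term f = 1 -> f * fps_inv f = 1.
Proof.
move=> f0; apply: funext => a; apply: funext => b; apply: funext => n.
have g1 : order_ge 1 (1 - f).
  by case=> [|a'] [|b'] [|n'] // _; rewrite -[LHS]/(1 - const_term f) f0 subrr.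
set K := (a + b + n).+1.
transitivity ((f * \sum_(k < K) (1 - f) ^+ k) a b n).
  rewrite -!fps_mulE; apply: eq_bigr => i _; apply: eq_bigr => j _.
  apply: eq_bigr => l _; congr (_ * _); rewrite fps_sum_apply /fps_inv.
  rewrite -(big_mkord xpredT
    (fun k => ((1 - f) ^+ k : fps_ring) (a - i)%N (b - j)%N (n - l)%N)).
  rewrite (@big_cat_nat _ _ _ (a - i + (b - j) + (n - l)).+1) //=; last by rewrite /K; lia.
  rewrite [X in _ + X]big_nat_cond [X in _ + X]big1 ?addr0; last first.
    by move=> k /andP[/andP[ltk _] _]; apply: (order_geX g1).
  by rewrite big_mkord; apply: eq_bigr => k _; rewrite fps_powE fps_subE fps_oneE.
have -> : f * \sum_(k < K) (1 - f) ^+ k = 1 - (1 - f) ^+ K.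
  have := subrX1 (1 - f) K; set s := \sum_(i < K) _ => E.
  have -> : f * s = - ((1 - f - 1) * s) by ring.
  by rewrite -E; ring.
rewrite -[LHS]/((1 : fps_ring) a b n - ((1 - f) ^+ K : fps_ring) a b n).
by rewrite (order_geX g1) ?subr0.
Qed.

Lemma const_termM f g : const_term (f * g) = const_term f * const_term g.
Proof. by rewrite -fps_mulE /const_term /fps_mul !big_ord1. Qed.

Lemma const_termX f k : const_term (f ^+ k) = const_term f ^+ k.
Proof. by elim: k => [|k IH] //; rewrite !exprS const_termM IH. Qed.

Lemma const_termB f g : const_term (f - g) = const_term f - const_term g.
Proof. by []. Qed.

Lemma const_term1 : const_term 1 = 1. Proof. by []. Qed.
Lemma const_termU : const_term fpsU = 0. Proof. by []. Qed.
Lemma const_termZ : const_term fpsZ = 0. Proof. by []. Qed.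
Lemma const_termT : const_term fpsT = 0. Proof. by []. Qed.

Definition const_termE :=
  (const_termM, const_termX, const_termB, const_term1, const_termU, const_termZ, const_termT).

(** * Comparison of coefficients and convergence of the sum *)

Definition negligible (M N : nat) (f : fps_ring) : Prop :=
  forall a b n, (a < M)%N -> (n < N)%N -> f a b n = 0.

Lemma negligibleD M N f g :
  negligible M N f -> negligible M N g -> negligible M N (f + g).
Proof.
move=> fn gn a b n la ln; rewrite -[LHS]/(f a b n + g a b n).
by rewrite fn ?gn ?addr0.
Qed.

Lemma negligibleU M N f : negligible M N (uS ^+ M * f).
Proof. by move=> a b n la _; rewrite coef_fpsUXM la. Qed.

Lemma negligibleT M N f : negligible M N (tS ^+ N * f).
Proof. by move=> a b n _ ln; rewrite coef_fpsTXM ln. Qed.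

Lemma coef_ascent_gf N a b n : (n <= N)%N ->
  (ascent_gf zS tS N uS 1) a b n = (asc_count a b n)%:R.
Proof.
move=> leN; rewrite /ascent_gf fps_sum_apply.
have coefm m : (tS ^+ m.+1 * ascent_poly zS m uS 1) a b n =
    (if m.+1 == n then asc_count a b n else 0)%:R.
  rewrite /ascent_poly mulr_sumr fps_sum_apply.
  under eq_bigr => w _ do rewrite expr1n mulr1 mulrC coef_fps_monomial.
  rewrite -natr_sum; congr _%:R; case: eqP => [<-|_]; last first.
    by apply: big1 => w _; rewrite !andbF.
  rewrite asc_countS -sum1_count [RHS]big_mkcond; apply: eq_bigr => w _.
  by rewrite andbT; case: ifP.
under eq_bigr do rewrite coefm.
(* Only the term of index [n - 1] contributes to [t ^+ n]; for length 0 both sides are zero. *)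
rewrite -natr_sum; congr _%:R; case: n leN {coefm} => [|n] ltnN.
  by rewrite asc_count0; apply: big1.
by rewrite -big_mkcond (big_pred1 (Ordinal ltnN)).
Qed.

Lemma deltaE s : (delta s : fps_ring) = deltaR uS tS s.
Proof.
rewrite /delta; case: eqP => [->|_]; first by rewrite fps_oneE /deltaR expr0 mul1r subKr.
by rewrite !(fps_subE, fps_mulE, fps_powE, fps_oneE).
Qed.

Lemma gammaE s : (gamma s : fps_ring) = gammaR uS zS tS s.
Proof. by rewrite /gamma !(fps_subE, fps_mulE, fps_powE, fps_oneE). Qed.

Lemma const_term_delta s : const_term (delta s) = 1.
Proof. by rewrite deltaE !const_termE subr0 expr1n !sub0r mul1r opprK. Qed.

Lemma const_term_gamma s : const_term (gamma s) = 1.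
Proof. by rewrite gammaE !const_termE mul0r subr0 expr1n !sub0r !mul1r opprK. Qed.

Lemma const_term_gamma_prod s : const_term (gamma_prod uS zS tS s) = 1.
Proof.
elim: s => [|s IH]; first by rewrite /gamma_prod big_geq.
by rewrite gamma_prodS const_termM IH -gammaE const_term_gamma mulr1.
Qed.

(** Uniqueness of inverses; it splits the single inverse in [summand] into the two factors produced
    by the iteration. *)
Lemma right_inverse_mul (R : comNzRingType) (x y x' y' w : R) :
  x * x' = 1 -> y * y' = 1 -> x * y * w = 1 -> w = x' * y'.
Proof.
move=> xV yV xyV; rewrite -[LHS]mul1r -[X in X * _]mulr1 -{1}xV -yV -[RHS]mulr1 -xyV.
by ring.
Qed.

Lemma fps_invM f g : const_term f = 1 -> const_term g = 1 ->
  fps_inv ((f : fps_ring) * (g : fps_ring)) = (fps_inv f : fps_ring) * (fps_inv g : fps_ring).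
Proof.
move=> f1 g1; apply: (right_inverse_mul (fps_mulV f1) (fps_mulV g1)).
by apply: fps_mulV; rewrite const_termM f1 g1 mulr1.
Qed.

Lemma summandE s : (summand s : fps_ring) =
  zS * tS * (1 - uS) * (uS ^+ s * (1 - tS) ^+ s) *
  ((fps_inv (delta s) : fps_ring) * (fps_inv (gamma_prod uS zS tS s.+1) : fps_ring)).
Proof.
have -> : gamma_prod uS zS tS s.+1 = \prod_(1 <= i < s.+2) (gamma i : fps_ring).
  by apply: eq_bigr => i _; rewrite gammaE.
rewrite -fps_invM ?const_term_delta//.
  by rewrite /summand fps_prodE !(fps_subE, fps_mulE, fps_powE, fps_oneE).
rewrite -(const_term_gamma_prod s.+1); congr const_term.
by apply: eq_bigr => i _; rewrite gammaE.
Qed.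

Theorem theorem6 : fps_sums_to summand H_v1.
Proof.
(* For [M > a] the tail divisible by [u ^+ M] cannot reach the coefficient of [u ^+ a]. *)
move=> a b n; exists a.+1 => M leM.
have idE s : deltaR uS tS s * fps_inv (delta s) = 1.
  by rewrite -deltaE; apply: fps_mulV; exact: const_term_delta.
have igE s : gamma_prod uS zS tS s * fps_inv (gamma_prod uS zS tS s) = 1.
  by apply: fps_mulV; exact: const_term_gamma_prod.
(* Cutting at length [n] keeps every sequence counted by the coefficient, while the truncation error
   starts at [t ^+ n.+1]. *)
have [r E] := ascent_gf_partial_sum n fpsT_lreg idE igE M.
have partial_sum : \sum_(s < M) (summand s : fps_ring) = ascent_gf zS tS n uS 1 -
    (uS ^+ M * (iterate_gf uS zS tS n (fun s => fps_inv (delta s)) M *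
      fps_inv (gamma_prod uS zS tS M)) + tS ^+ n.+1 * r).
  by rewrite E -[X in X - _]addrA addrK; apply: eq_bigr => s _; exact: summandE.
transitivity ((\sum_(s < M) (summand s : fps_ring)) a b n); first by rewrite fps_sum_apply.
rewrite partial_sum -[RHS](coef_ascent_gf a b (leqnn n)).
rewrite -[LHS]/(_ a b n - _ a b n) [X in _ - X](_ : _ = 0) ?subr0//.
apply: (@negligibleD M n.+1) => //; [exact: negligibleU | exact: negligibleT].
Qed.
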